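(* If $A$ is an irreducible $C^{*}$-subalgebra of $\mathcal{F}_{n}$, i.e. $A'\cap\mathcal{F}_{n}=\mathbb{C}$, then $A'\cap \mathcal{O}_{n}=\mathbb{C}$.
   Context: $\mathcal{O}_{n}$ ($2\le n<\infty$) is the Cuntz algebra, the $C^{*}$-algebra generated by isometries $S_{1},\dots,S_{n}$ satisfying $\sum_{i=1}^{n}S_{i}S_{i}^{*}=1$. The gauge action $\gamma_{z}$ ($z\in\mathbb{T}$) on $\mathcal{O}_{n}$ is the action by automorphisms with $\gamma_{z}(S_{i})=zS_{i}$. $\mathcal{F}_{n}\subset\mathcal{O}_{n}$ is the fixed point algebra of the gauge action; it is isomorphic to the UHF-algebra of type $n^{\infty}$. For $A\subset C$, $A'\cap C=\{x\in C : xa=ax \text{ for all } a\in A\}$. $\mathbb{C}$ denotes the scalar multiples of the unit $1$. *)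

(* Defs.v *)
From HB Require Import structures.
From mathcomp Require Import all_boot all_order all_algebra.
From mathcomp Require Import complex.
From mathcomp Require Import all_classical all_reals all_analysis.

Set Implicit Arguments.
Unset Strict Implicit.
Unset Printing Implicit Defensive.

Import Order.TTheory GRing.Theory Num.Theory.
Import numFieldNormedType.Exports.

Local Open Scope classical_set_scope.
Local Open Scope ring_scope.
Local Open Scope complex_scope.

(** Unital complex C*-algebras.  The scalars are [R[i]] for [R] a model of the
    real numbers; the norm of a normed module over [R[i]] takes its values in
    the nonnegative, hence real, elements of [R[i]].  [cs_one_neq0] excludes the
    zero algebra, in which the Cuntz relations hold trivially.

    The product is a field of the record, and not inherited from [algType],
    because a structure joining normed modules and rings cannot be declared on
    top of the existing hierarchy ([numDomainType] is already below both).  The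
    carrier is equipped with the library's algebra structure right after. *)
Record cstarAlg (R : realType) := CStarAlg {
  cs_space : completeNormedModType R[i] ;
  cs_one : cs_space ;
  cs_mul : cs_space -> cs_space -> cs_space ;
  cs_star : cs_space -> cs_space ;
  cs_mulA : associative cs_mul ;
  cs_mul1l : left_id cs_one cs_mul ;
  cs_mul1r : right_id cs_one cs_mul ;
  cs_mulDl : left_distributive cs_mul +%R ;
  cs_mulDr : right_distributive cs_mul +%R ;
  cs_one_neq0 : cs_one != 0 ;
  cs_scaleAl : forall (k : R[i]) x y, k *: cs_mul x y = cs_mul (k *: x) y ;
  cs_scaleAr : forall (k : R[i]) x y, k *: cs_mul x y = cs_mul x (k *: y) ;
  cs_starK : involutive cs_star ;
  cs_starD : {morph cs_star : x y / x + y} ;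
  cs_starZ : forall (k : R[i]) x, cs_star (k *: x) = k^* *: cs_star x ;
  cs_starM : forall x y, cs_star (cs_mul x y) = cs_mul (cs_star y) (cs_star x) ;
  cs_normM : forall x y, `|cs_mul x y| <= `|x| * `|y| ;
  cs_norm_star : forall x, `|cs_mul (cs_star x) x| = `|x| ^+ 2
}.

Definition cs_sort (R : realType) (O : cstarAlg R) : Type := cs_space O.
Coercion cs_sort : cstarAlg >-> Sortclass.

Section CStarInstances.
Context {R : realType} (O : cstarAlg R).

HB.instance Definition _ := CompleteNormedModule.copy (cs_sort O) (cs_space O).

HB.instance Definition _ := GRing.Zmodule_isNzRing.Build (cs_sort O)
  (@cs_mulA R O) (@cs_mul1l R O) (@cs_mul1r R O)
  (@cs_mulDl R O) (@cs_mulDr R O) (@cs_one_neq0 R O).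

HB.instance Definition _ :=
  GRing.Lmodule_isLalgebra.Build R[i] (cs_sort O) (@cs_scaleAl R O).

HB.instance Definition _ :=
  GRing.Lalgebra_isAlgebra.Build R[i] (cs_sort O) (@cs_scaleAr R O).

Definition star (x : O) : O := cs_star x.

End CStarInstances.

Section CStarTheory.
Context {R : realType} {O : cstarAlg R}.
Implicit Types (A B : set O) (alpha : O -> O).

(** C*-subalgebras are not required to contain the unit of [O]. *)
Record cstar_subalgebra A : Prop := CStarSubalgebra {
  csub0 : A 0 ;
  csubD : forall x y, A x -> A y -> A (x + y) ;
  csubZ : forall (k : R[i]) x, A x -> A (k *: x) ;
  csubM : forall x y, A x -> A y -> A (x * y) ;
  csub_star : forall x, A x -> A (star x) ;
  csub_closed : closed A
}.

Definition cstar_generated (G : set O) : set O := smallest cstar_subalgebra G.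

Record star_automorphism alpha : Prop := StarAutomorphism {
  saut_linear : linear alpha ;
  saut_monoid : monoid_morphism alpha ;
  saut_star : {morph alpha : x / star x} ;
  saut_bij : bijective alpha
}.

(** [A' `&` B] *)
Definition relative_commutant A B : set O :=
  [set x | B x /\ forall a, A a -> x * a = a * x].

Definition scalars : set O := range (fun k : R[i] => k%:A).

Definition isometry_elt (s : O) : Prop := star s * s = 1.

(** [O] together with [S] is the Cuntz algebra on [n] generators.  The unit
    need not be added to the generators, since it is [\sum_i S i * star (S i)]. *)
Record cuntz_algebra n (S : 'I_n -> O) : Prop := CuntzAlgebra {
  cuntz_isometry : forall i, isometry_elt (S i) ;
  cuntz_sum : \sum_(i < n) S i * star (S i) = 1 ;
  cuntz_generated : cstar_generated (range S) = setT
}.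

(** The circle group is the set of [z : R[i]] of norm [1]; the values of
    [gamma] elsewhere are irrelevant. *)
Record gauge_action n (S : 'I_n -> O) (gamma : R[i] -> O -> O) : Prop :=
  GaugeAction {
  gauge_aut : forall z, `|z| = 1 -> star_automorphism (gamma z) ;
  gauge1 : gamma 1 =1 id ;
  gaugeM : forall z w, `|z| = 1 -> `|w| = 1 ->
    gamma (z * w) =1 gamma z \o gamma w ;
  gauge_gen : forall z i, `|z| = 1 -> gamma z (S i) = z *: S i
}.

Definition gauge_fixed (gamma : R[i] -> O -> O) : set O :=
  [set x | forall z, `|z| = 1 -> gamma z x = x].

End CStarTheory.

Arguments scalars {R} O.

(* Main.v *)
(** Split an element [x] commuting with [A] into its spectral components for the
    gauge action.  Since [A] is fixed by that action, the components commute with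
    [A] as well, and if [y] is one of them then [y y^*] is fixed and commutes with
    [A], hence is a scalar.  In positive degree [k] this forces [y = 0]: [y] is a
    limit of combinations of the [S_u S_v^*] with [|u| = m + k] and [|v| = m],
    that is of matrices with more rows than columns, which have a left kernel.
    Negative degrees follow by taking adjoints.  So only the component of degree
    [0] survives; it lies in [F_n] and is a scalar.

    The components are limits of averages over roots of unity, and Fejér sums of
    these averages recover [x]; no integration is needed. *)

Require Import Defs.
From mathcomp Require Import all_boot all_order all_algebra.
From mathcomp Require Import cyclic separable cyclotomic.
From mathcomp Require Import complex lra zify.
From mathcomp Require Import all_classical all_reals all_analysis.

Set Implicit Arguments.
Unset Strict Implicit.
Unset Printing Implicit Defensive.

Import Order.TTheory GRing.Theory Num.Theory.
Import numFieldNormedType.Exports.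

Local Open Scope classical_set_scope.
Local Open Scope ring_scope.
Local Open Scope complex_scope.

(** * The norm as a real number, adjoints, completeness *)

Section Norm.
Context {R : realType} {O : cstarAlg R}.
Implicit Types (x y : O) (k : R[i]).

(** The norm of [O] has values in [R[i]]. Its real part carries the same information and moves
    estimates to [R], where linear arithmetic applies. *)
Definition rnorm x : R := complex.Re `|x|.

Lemma rnormE x : (rnorm x)%:C = `|x|.
Proof. exact/RRe_real/normr_real. Qed.

Lemma rnorm_ge0 x : 0 <= rnorm x.
Proof. rewrite -lecR rnormE; exact: normr_ge0. Qed.

Lemma rnorm0 : rnorm 0 = 0.
Proof. by apply: complexI; rewrite rnormE normr0. Qed.

Lemma rnormN x : rnorm (- x) = rnorm x.
Proof. by rewrite /rnorm normrN. Qed.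

Lemma rnormC x y : rnorm (x - y) = rnorm (y - x).
Proof. by rewrite -rnormN opprB. Qed.

Lemma rnormD x y : rnorm (x + y) <= rnorm x + rnorm y.
Proof. by rewrite -lecR rmorphD /= !rnormE ler_normD. Qed.

Lemma rnormB x y : rnorm (x - y) <= rnorm x + rnorm y.
Proof. by rewrite -[rnorm y]rnormN rnormD. Qed.

Lemma rnormM x y : rnorm (x * y) <= rnorm x * rnorm y.
Proof. by rewrite -lecR rmorphM /= !rnormE; apply: cs_normM. Qed.

Lemma rnormZ k x : rnorm (k *: x) = complex.Re `|k| * rnorm x.
Proof.
apply: complexI; rewrite rmorphM /= !rnormE normrZ.
by congr (_ * _); apply/esym/RRe_real/normr_real.
Qed.

Lemma rnormZ1 k x : `|k| = 1 -> rnorm (k *: x) = rnorm x.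
Proof. by move=> k1; rewrite rnormZ k1 mul1r. Qed.

Lemma rnormZr (r : R) x : 0 <= r -> rnorm (r%:C *: x) = r * rnorm x.
Proof. by move=> r0; rewrite rnormZ ger0_norm ?ler0c. Qed.

Lemma rnorm_eq0 x : rnorm x = 0 -> x = 0.
Proof. by move=> x0; apply/normr0_eq0; rewrite -rnormE x0. Qed.

Lemma rnorm_sum (I : Type) (r : seq I) (P : pred I) (F : I -> O) :
  rnorm (\sum_(i <- r | P i) F i) <= \sum_(i <- r | P i) rnorm (F i).
Proof.
elim/big_rec2: _ => [|i u v _ uv]; first by rewrite rnorm0.
by apply: le_trans (rnormD _ _) _; rewrite lerD2l.
Qed.

Lemma rnorm_small x : (forall e : R, 0 < e -> rnorm x <= e) -> x = 0.
Proof.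
move=> xe; apply: rnorm_eq0; apply/eqP; rewrite eq_le rnorm_ge0 andbT.
by apply/ler_addgt0Pl => e e0; rewrite addr0 xe.
Qed.

Lemma rnorm_sub_small (c : R) x y :
  (forall e : R, 0 < e -> rnorm (x - y) <= c * e) -> x = y.
Proof.
move=> xye; apply/eqP; rewrite -subr_eq0; apply/eqP/rnorm_small => e e0.
have c0 : 0 < `|c| + 1 by rewrite ltr_pwDr.
apply: le_trans (xye (e / (`|c| + 1)) (divr_gt0 e0 c0)) _.
rewrite mulrCA ger_pMr // ler_pdivrMr // mul1r.
by apply: le_trans (ler_norm _) _; rewrite lerDl.
Qed.

Lemma starK : involutive (@star R O). Proof. exact: cs_starK. Qed.

Lemma starD x y : star (x + y) = star x + star y.
Proof. exact: cs_starD. Qed.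

Lemma starZ k x : star (k *: x) = conjc k *: star x.
Proof. exact: cs_starZ. Qed.

Lemma starM x y : star (x * y) = star y * star x.
Proof. exact: cs_starM. Qed.

Lemma star0 : star (0 : O) = 0.
Proof. by apply: (addrI (star 0)); rewrite -starD !addr0. Qed.

Lemma starN x : star (- x) = - star x.
Proof. by apply/eqP; rewrite -subr_eq0 opprK -starD addNr star0. Qed.

Lemma star1 : star (1 : O) = 1.
Proof.
transitivity (star (1 * star (1 : O))); first by rewrite starM starK mul1r.
by rewrite mul1r starK.
Qed.

Lemma rnorm_starM x : rnorm (star x * x) = rnorm x ^+ 2.
Proof.
by apply: complexI; rewrite rmorphXn /= !rnormE; apply: cs_norm_star.
Qed.

(** One inequality is [rnorm y ^+ 2 = rnorm (star y * y) <= rnorm (star y) * rnorm y]; the other is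
    the same at [star x]. *)
Lemma rnorm_star x : rnorm (star x) = rnorm x.
Proof.
have H y : rnorm y <= rnorm (star y).
  have [->|y0] := eqVneq (rnorm y) 0; first exact: rnorm_ge0.
  have yp : 0 < rnorm y by rewrite lt_def y0 rnorm_ge0.
  by rewrite -(ler_pM2r yp) -expr2 -rnorm_starM rnormM.
by apply/eqP; rewrite eq_le H -{2}(starK x) H.
Qed.

Lemma rnorm1 : rnorm (1 : O) = 1.
Proof.
have : rnorm (1 : O) ^+ 2 = rnorm (1 : O) by rewrite -rnorm_starM star1 mulr1.
move/eqP; rewrite expr2 -subr_eq0 -{3}[rnorm _]mulr1 -mulrBr mulf_eq0 subr_eq0.
case/orP => /eqP // /rnorm_eq0 /eqP; by rewrite oner_eq0.
Qed.

Lemma rnorm_alg k : rnorm (k%:A : O) = complex.Re `|k|.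
Proof. by rewrite rnormZ rnorm1 mulr1. Qed.

Lemma rnorm_isometry x : star x * x = 1 -> rnorm x = 1.
Proof.
move=> xx; have := rnorm_starM x; rewrite xx rnorm1 => /esym/eqP.
by rewrite sqrp_eq1 ?rnorm_ge0 // => /eqP.
Qed.

Lemma rnorm_complete (u : nat -> O) :
  (forall e : R, 0 < e ->
    exists N, forall m n, (N <= m)%N -> (N <= n)%N -> rnorm (u m - u n) < e) ->
  exists l : O, forall e : R, 0 < e ->
    exists N, forall n, (N <= n)%N -> rnorm (u n - l) < e.
Proof.
move=> uC.
have cu : cvg (u @ \oo).
  apply: cauchy_cvg; apply: cauchy_exP => e /= e0.
  have e1 : 0 < complex.Re e by move: e0; rewrite ltcE => /andP[].
  have eE : (complex.Re e)%:C = e by apply: RRe_real; apply: gtr0_real.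
  have [N HN] := uC _ e1.
  exists (u N); exists N => //= n /= Nn.
  rewrite -ball_normE /= -eE -rnormE ltcR; exact: HN.
exists (lim (u @ \oo)) => e e0.
have e0' : (0 : R[i]) < e%:C by rewrite ltcR.
move/cvgrPdist_lt: cu => /(_ _ e0') [N _ HN].
by exists N => n Nn; rewrite -ltcR rnormC rnormE; apply: HN.
Qed.

Lemma rnorm_closed (D : set O) :
  (forall x, (forall e : R, 0 < e -> exists2 y, D y & rnorm (x - y) < e) ->
    D x) -> closed D.
Proof.
move=> HD x cx; apply: HD => e e0.
have e0' : (0 : R[i]) < e%:C by rewrite ltcR.
have [y [Dy]] := cx _ (nbhsx_ballx x _ e0').
by rewrite -ball_normE /= -rnormE ltcR; exists y.
Qed.

End Norm.

(** * Square roots near the unit, and boundedness of star-automorphisms *)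

Section Automorphism.
Context {R : realType} {O : cstarAlg R}.
Implicit Types (x y : O).

Local Notation half := ((2^-1 : R)%:C).

Lemma star_real (r : R) x : star (r%:C *: x) = r%:C *: star x.
Proof. by rewrite starZ; congr (_ *: _); apply: conjc_real. Qed.

Lemma half2 x : half *: (x + x) = x.
Proof.
rewrite scalerDr -scalerDl -rmorphD /=.
by rewrite (_ : 2^-1 + 2^-1 = 1 :> R) ?scale1r //; lra.
Qed.

Lemma sqr_half_bound (u : R) : 0 <= u -> u <= 2^-1 -> u * u <= 4^-1.
Proof. by move=> *; nra. Qed.

(** [1 - sqrt (1 - q)] is the fixed point of [w |-> (q + w ^+ 2) / 2]. *)
Fixpoint sqrt_iter q (k : nat) : O :=
  if k is k'.+1 then half *: (q + sqrt_iter q k' * sqrt_iter q k') else 0.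

Section SqrtIter.
Variable q : O.
Hypotheses (qs : star q = q) (qn : rnorm q <= 3 / 4).
Local Notation w := (sqrt_iter q).

Lemma sqrt_iter_star k : star (w k) = w k.
Proof.
elim: k => [|k IH] /=; first exact: star0.
by rewrite star_real starD !starM qs IH.
Qed.

Lemma sqrt_iter_comm z k : q * z = z * q -> w k * z = z * w k.
Proof.
move=> qz; elim: k => [|k IH] /=; first by rewrite mul0r mulr0.
rewrite -scalerAl -scalerAr mulrDl mulrDr qz; congr (_ *: (_ + _)).
by rewrite -mulrA IH mulrA IH mulrA.
Qed.

(** The ball of radius 1/2 is stable because (3/4 + 1/4) / 2 = 1/2, whence the bound 3/4 on [q]. *)
Lemma sqrt_iter_le k : rnorm (w k) <= 2^-1.
Proof.
elim: k => [|k IH] /=; first by rewrite rnorm0 invr_ge0.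
rewrite rnormZr ?invr_ge0 //.
have := rnormD q (w k * w k); have := rnormM (w k) (w k).
have := sqr_half_bound (rnorm_ge0 (w k)) IH; have := qn.
lra.
Qed.

Lemma sqr_contract (u v : O) : rnorm u <= 2^-1 -> rnorm v <= 2^-1 ->
  rnorm (half *: (q + u * u) - half *: (q + v * v)) <=
  2^-1 * rnorm (u - v).
Proof.
move=> un vn; rewrite -scalerBr rnormZr ?invr_ge0 // ler_pM2l ?invr_gt0 //.
have -> : q + u * u - (q + v * v) = u * (u - v) + (u - v) * v.
  by rewrite mulrBr mulrBl addrA subrK opprD addrACA subrr add0r.
apply: le_trans (rnormD _ _) _.
have h1 := le_trans (rnormM u (u - v)) (ler_wpM2r (rnorm_ge0 _) un).
have h2 := le_trans (rnormM (u - v) v) (ler_wpM2l (rnorm_ge0 _) vn).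
lra.
Qed.

Lemma half_exp_small (e : R) : 0 < e -> exists N, (2^-1 : R) ^+ N < e.
Proof.
move=> e0; have := @cvg_geometric R 1 (2^-1).
rewrite ger0_norm ?invr_ge0 // invf_lt1 ?ltr1n // => /(_ isT).
move/cvgrPdist_lt => /(_ _ e0) [N _ /(_ N (leqnn _))] /=.
rewrite sub0r normrN /geometric /= mul1r ger0_norm ?exprn_ge0 ?invr_ge0 //.
by exists N.
Qed.

(** Each of the [N] common steps halves a distance that starts below the diameter 1 of the ball of
    radius 1/2. *)
Lemma sqrt_iter_dist N k m :
  rnorm (w (N + k)%N - w (N + m)%N) <= (2^-1) ^+ N.
Proof.
elim: N => [|N IH].
  rewrite !add0n expr0; have := rnormB (w k) (w m).
  by have := sqrt_iter_le k; have := sqrt_iter_le m; lra.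
rewrite !addSn exprS /=; apply: le_trans (sqr_contract _ _) _;
  try exact: sqrt_iter_le.
by rewrite ler_pM2l ?invr_gt0.
Qed.

Lemma sqrt_iter_lim : exists2 l : O, rnorm l <= 2^-1 &
  forall e : R, 0 < e -> exists2 k, rnorm (w k - l) < e & rnorm (w k.+1 - l) < e.
Proof.
have [e e0|l Hl] := @rnorm_complete R O w.
  have [N HN] := half_exp_small e0.
  exists N => m k Nm Nk; rewrite -(subnKC Nm) -(subnKC Nk).
  exact: le_lt_trans (sqrt_iter_dist _ _ _) HN.
exists l => [|e /Hl[N HN]]; last by exists N; apply: HN.
apply/ler_addgt0Pl => e /Hl[N /(_ N (leqnn _)) HN].
have := rnormB (w N) (w N - l); rewrite subKr.
have := sqrt_iter_le N; lra.
Qed.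

(** The limit [l] of the iteration solves [l + l = q + l * l], so [1 - l] squares to [1 - q].
    Self-adjointness and commutation pass to the limit. *)
Lemma exists_sqrt : exists b : O,
  [/\ star b = b, forall z, q * z = z * q -> b * z = z * b & b * b = 1 - q].
Proof.
have [l ln Hl] := sqrt_iter_lim.
have ls : star l = l.
  apply: (@rnorm_sub_small _ _ 2) => e /Hl[k kl _].
  have -> : star l - l = w k - l - star (w k - l).
    by rewrite starD starN sqrt_iter_star opprB [RHS]addrC addrA subrK.
  apply: le_trans (rnormB _ _) _; rewrite rnorm_star; lra.
have lc z : q * z = z * q -> l * z = z * l.
  move=> qz; apply: (@rnorm_sub_small _ _ (2 * rnorm z)) => e /Hl[k kl _].
  have -> : l * z - z * l = z * (w k - l) - (w k - l) * z.
    by rewrite mulrBr mulrBl sqrt_iter_comm // opprB [RHS]addrC addrA subrK.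
  apply: le_trans (rnormB _ _) _.
  have := rnormM z (w k - l); have := rnormM (w k - l) z.
  have := ler_wpM2l (rnorm_ge0 z) (ltW kl).
  lra.
have lE : l = half *: (q + l * l).
  apply: (@rnorm_sub_small _ _ 2) => e e0; have [k kl kl'] := Hl _ e0.
  have -> : l - half *: (q + l * l) =
    (w k.+1 - half *: (q + l * l)) - (w k.+1 - l).
    by rewrite opprB [RHS]addrC addrA subrK.
  apply: le_trans (rnormB _ _) _.
  have /= := sqr_contract (sqrt_iter_le k) ln.
  move: kl kl' => /=; lra.
have l2 : l + l = q + l * l by rewrite [in LHS]lE -scalerDr half2.
exists (1 - l); split.
- by rewrite starD starN star1 ls.
- by move=> z qz; rewrite mulrBr mulrBl mul1r mulr1 lc.
- rewrite mulrBr mulr1 mulrBl mul1r opprB addrACA.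
  have -> : q = l + l - l * l by rewrite l2 addrK.
  by rewrite opprB opprD [RHS]addrA.
Qed.

End SqrtIter.

Lemma cartesian (a b : O) : star a = a -> star b = b -> b * a = a * b ->
  let u := a + 'i *: b in let v := a - 'i *: b in
  [/\ star u = v, v * u = a * a + b * b & half *: (u + v) = a].
Proof.
move=> sa sb ba /=; split.
- rewrite starD sa starZ sb -scaleNr; congr (_ + _ *: _).
  by apply/eqP; rewrite eq_complex /= oppr0 !eqxx.
- rewrite mulrDr !mulrBl -!scalerAl -!scalerAr ba scalerA.
  rewrite (_ : 'i * 'i = -1); last by rewrite -expr2 sqr_i.
  by rewrite scaleN1r opprK addrA subrK.
- by rewrite addrACA subrr addr0 half2.
Qed.

(** [a] is the mean of [a + i b] and its adjoint [a - i b], whose product is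
    [a ^+ 2 + b ^+ 2]. *)
Lemma rnorm_sqrD (a b : O) : star a = a -> star b = b -> b * a = a * b ->
  rnorm a ^+ 2 <= rnorm (a * a + b * b).
Proof.
move=> sa sb ba; have [us vu uv] := cartesian sa sb ba.
set u := a + 'i *: b in us vu uv *.
rewrite -vu -us rnorm_starM lerXn2r ?nnegrE ?rnorm_ge0 // -[a in rnorm a]uv.
rewrite rnormZr ?invr_ge0 //.
by have := rnormD u (star u); rewrite rnorm_star us; lra.
Qed.

(** [h ^+ 2] is turned into [(1 + h ^+ 2) ^+ 2 - 1 = (h * sqrt (2 + h ^+ 2)) ^+ 2],
    whose norm is at least twice as large. *)
Lemma rnorm_add1_sqr (h : O) : star h = h -> rnorm (1 + h * h) <= 1 -> h = 0.
Proof.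
move=> hs hn; apply: rnorm_small => e e0.
suff H k : rnorm h ^+ 2 <= (2^-1) ^+ k.
  rewrite -ler_sqr ?nnegrE ?rnorm_ge0 ?(ltW e0) //.
  have [N HN] := half_exp_small (exprn_gt0 2 e0).
  exact: le_trans (H N) (ltW HN).
elim: k h hs hn {e e0} => [|k IH] h hs hn.
  have := @rnorm_sqrD h 1 hs star1; rewrite !mul1r mulr1 addrC expr0.
  by move=> /(_ erefl) /le_trans; apply.
have h1 : rnorm (h * h) <= 1.
  have := @rnorm_sqrD h 1 hs star1; rewrite !mul1r mulr1 addrC => /(_ erefl).
  by rewrite -rnorm_starM hs => /le_trans; apply.
(* The root [b] obtained from this [q] satisfies [b * b = 1 + h * h / 2], so that the square root of
   2 times [h * b] squares to [2 h^2 + h^4]. *)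
pose q : O := - (half *: (h * h)).
have [||b [bs bc bb]] := @exists_sqrt q.
- by rewrite starN star_real starM hs.
- by rewrite rnormN rnormZr ?invr_ge0 //; move: h1; lra.
have bh : b * h = h * b.
  by apply: bc; rewrite /q mulNr mulrN -scalerAl -scalerAr mulrA.
pose c := (Num.sqrt 2 : R)%:C.
have cc (x : O) : c *: (c *: x) = x + x.
  rewrite scalerA -rmorphM -expr2 sqr_sqrtr //=.
  by rewrite (_ : (2 : R) = 1 + 1) // rmorphD /= scalerDl scale1r.
pose g := c *: (h * b).
have gs : star g = g by rewrite star_real starM hs bs bh.
have gg : g * g = h * h + h * h + (h * h) * (h * h).
  rewrite /g -scalerAl -scalerAr cc.
  have -> : (h * b) * (h * b) = (h * h) * (b * b).
    by rewrite mulrA -(mulrA h) bh mulrA -mulrA.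
  rewrite bb /q opprK mulrDr mulr1 -scalerAr.
  by rewrite addrACA -scalerDr half2.
have g1 : 1 + g * g = (1 + h * h) * (1 + h * h).
  by rewrite gg mulrDl mul1r mulrDr mulr1 !addrA.
have gn : rnorm (1 + g * g) <= 1.
  rewrite g1; apply: le_trans (rnormM _ _) _.
  by apply: mulr_ile1; rewrite ?rnorm_ge0.
have := IH g gs gn; rewrite -rnorm_starM gs gg.
(* This gives [2 * rnorm h ^+ 2 <= rnorm (g * g)], hence the factor 1/2 gained at each induction
   step. *)
have := @rnorm_sqrD (c *: h) (h * h).
have -> : (c *: h) * (c *: h) = h * h + h * h by rewrite -scalerAl -scalerAr cc.
rewrite star_real hs starM hs -scalerAl -scalerAr -(mulrA h h h).
move=> /(_ erefl erefl erefl).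
rewrite rnormZr ?sqrtr_ge0 // exprMn sqr_sqrtr //.
move=> a1 a2; rewrite [leRHS]exprS.
have := le_trans a1 a2; lra.
Qed.

(** The mean of the squares of [1 + g] and [1 - g] is [1 + g * g], which therefore lies in the unit
    ball. *)
Lemma extreme_one (g : O) :
  star g = g -> rnorm (1 + g) <= 1 -> rnorm (1 - g) <= 1 -> g = 0.
Proof.
move=> gs g1 g2; apply: rnorm_add1_sqr => //.
rewrite (_ : 1 + g * g = half *: ((1 + g) * (1 + g) + (1 - g) * (1 - g))).
  rewrite rnormZr ?invr_ge0 //; apply: le_trans (_ : 2^-1 * (1 + 1) <= 1).
    rewrite ler_pM2l ?invr_gt0 //; apply: le_trans (rnormD _ _) _.
    by apply: lerD; apply: le_trans (rnormM _ _) _;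
      apply: mulr_ile1; rewrite ?rnorm_ge0.
  by lra.
have -> : (1 + g) * (1 + g) + (1 - g) * (1 - g) =
          (1 + g * g) + (1 + g * g).
  have E (x : O) : (1 + x) * (1 + x) = (1 + x * x) + (x + x).
    by rewrite mulrDr mulr1 mulrDl mul1r [x + x * x]addrC addrACA.
  by rewrite !E mulrNN addrACA -opprD subrr addr0.
by rewrite half2.
Qed.

Lemma star_automorphismD alpha x y : @star_automorphism R O alpha ->
  alpha (x + y) = alpha x + alpha y.
Proof. by move=> [lin _ _ _]; have := lin 1 x y; rewrite !scale1r. Qed.

Lemma star_automorphism0 alpha : @star_automorphism R O alpha -> alpha 0 = 0.
Proof.
by move=> aut; apply: (addrI (alpha 0)); rewrite -star_automorphismD // !addr0.
Qed.

Lemma star_automorphismZ alpha k x : @star_automorphism R O alpha ->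
  alpha (k *: x) = k *: alpha x.
Proof.
move=> aut; have [lin _ _ _] := aut.
by have := lin k x 0; rewrite !addr0 star_automorphism0 // addr0.
Qed.

(** A self-adjoint [y] of norm at most [1/2] is the mean of the unitaries
    [y + i b] and [y - i b] with [b ^+ 2 = 1 - y ^+ 2], and unitaries are mapped
    to unitaries. *)
Lemma star_automorphism_half alpha y : @star_automorphism R O alpha ->
  star y = y -> rnorm y <= 2^-1 -> rnorm (alpha y) <= 1.
Proof.
move=> aut ys yn; have [_ [alpha1 alphaM] alphas _] := aut.
have [||b [bs by_ bb]] := @exists_sqrt (y * y).
- by rewrite starM ys.
- apply: le_trans (rnormM _ _) _.
  have := sqr_half_bound (rnorm_ge0 y) yn; lra.
have [us vu uv] := cartesian ys bs (by_ y (esym (mulrA _ _ _))).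
set u := y + _ in us vu uv; set v := y - _ in us vu uv.
rewrite bb addrC subrK in vu.
have au : rnorm (alpha u) = 1.
  by apply: rnorm_isometry; rewrite -alphas us -alphaM vu.
have av : rnorm (alpha v) = 1 by rewrite -us alphas rnorm_star.
rewrite -uv.
rewrite star_automorphismZ // star_automorphismD // rnormZr ?invr_ge0 //.
have := rnormD (alpha u) (alpha v); rewrite au av; lra.
Qed.

(** Continuity is derived from algebra: [star x * x], scaled to norm 1/2, has an image of norm at
    most 1, so [rnorm (alpha x) ^+ 2 <= 2 * rnorm x ^+ 2]. The factor 2 is crude, but only its
    uniformity matters. *)
Lemma star_automorphism_bound alpha x : @star_automorphism R O alpha ->
  rnorm (alpha x) <= 2 * rnorm x.
Proof.
move=> aut; have [_ [_ alphaM] alphas _] := aut.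
have [x0|xn0] := eqVneq (rnorm x) 0.
  by rewrite (rnorm_eq0 x0) star_automorphism0 // rnorm0 mulr0.
have xp : 0 < rnorm x by rewrite lt_def xn0 rnorm_ge0.
pose c := 2^-1 / rnorm x ^+ 2.
have c0 : 0 < c by rewrite divr_gt0 ?invr_gt0 ?exprn_gt0.
have := @star_automorphism_half alpha (c%:C *: (star x * x)) aut.
rewrite star_real starM starK => /(_ erefl).
rewrite star_automorphismZ // alphaM alphas !rnormZr ?(ltW c0) // !rnorm_starM.
rewrite /c divfK ?expf_neq0 // => /(_ (lexx _)).
rewrite mulrAC ler_pdivrMr ?exprn_gt0 // mul1r => h.
have a0 := rnorm_ge0 (alpha x); rewrite leNgt; apply/negP => h'.
nra.
Qed.

End Automorphism.

(** * Characters of the circle at roots of unity *)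

Section RootsOfUnity.
Context {R : realType}.
Local Notation C := R[i].

Lemma prim_root_exists (F : numClosedFieldType) (N : nat) : (0 < N)%N ->
  exists z : F, N.-primitive_root z.
Proof.
move=> N0; have [r] := closed_field_poly_normal ('X^N - 1 : {poly F}).
rewrite lead_coefXnsubC // scale1r => Dp.
have rN1 : all N.-unity_root r.
  by apply/allP=> z; rewrite -root_prod_XsubC -Dp.
have szr : (N < (size r).+1)%N.
  by rewrite -(size_prod_XsubC r id) -Dp size_XnsubC.
have [|z _ zN] := hasP (has_prim_root N0 rN1 _ szr); last by exists z.
by rewrite -separable_prod_XsubC -Dp separable_Xn_sub_1 // pnatr_eq0 -lt0n.
Qed.

(** The character of integer degree [a - b], kept as a pair of naturals to match the two word
    lengths in [homog a b]. *)
Definition chi (a b : nat) (z : C) : C := z ^+ a / z ^+ b.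

Lemma norm1_neq0 (z : C) : `|z| = 1 -> z != 0.
Proof. by move=> z1; rewrite -normr_eq0 z1 oner_eq0. Qed.

Lemma norm_chi a b z : `|z| = 1 -> `|chi a b z| = 1.
Proof. by move=> z1; rewrite /chi normf_div !normrX z1 !expr1n divr1. Qed.

Lemma chiM a b c d z : chi a b z * chi c d z = chi (a + c) (b + d) z.
Proof. by rewrite /chi mulf_div !exprD. Qed.

Lemma chi_diag a z : `|z| = 1 -> chi a a z = 1.
Proof. by move=> z1; rewrite /chi divff ?expf_neq0 ?norm1_neq0. Qed.

Lemma chi_eq a b c d z : `|z| = 1 -> (a + d = c + b)%N -> chi a b z = chi c d z.
Proof.
move=> z1 ad; apply/eqP; rewrite /chi eqr_div ?expf_neq0 ?norm1_neq0 //.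
by rewrite -!exprD ad.
Qed.

Lemma conj_chi a b z : `|z| = 1 -> conjc (chi a b z) = chi b a z.
Proof.
move=> z1; have zc : conjc z = z^-1.
  apply: (mulfI (norm1_neq0 z1)); rewrite divff ?norm1_neq0 //.
  by rewrite -sqr_normc z1 expr1n.
by rewrite /chi fmorph_div !rmorphXn /= zc !exprVn invrK mulrC.
Qed.

(** A geometric sum whose ratio [w ^+ a / w ^+ b] is an [N]-th root of unity, equal to 1 only if
    [a = b] since both exponents are below [N]. *)
Lemma sum_chi N (w : C) a b : N.-primitive_root w ->
  (a < N)%N -> (b < N)%N ->
  \sum_(j < N) chi a b (w ^+ j) = if a == b then N%:R else 0.
Proof.
move=> wN aN bN.
have w0 : w != 0 by rewrite (prim_root_eq0 wN) -lt0n (prim_order_gt0 wN).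
have cE j : chi a b (w ^+ j) = (w ^+ a / w ^+ b) ^+ j.
  by rewrite /chi exprMn exprVn -!exprM mulnC [(j * b)%N]mulnC.
under eq_bigr => j _ do rewrite cE.
case: eqVneq => [->|ab].
  rewrite divff ?expf_neq0 //; under eq_bigr => j _ do rewrite expr1n.
  by rewrite sumr_const card_ord.
set v := w ^+ a / w ^+ b.
have v1 : v != 1.
  rewrite /v; apply: contra ab => /eqP v1.
  have := divfK (expf_neq0 b w0) (w ^+ a); rewrite v1 mul1r => /esym/eqP.
  by rewrite (eq_prim_root_expr wN) !modn_small.
have vN : v ^+ N = 1.
  rewrite /v exprMn exprVn -!exprM mulnC exprM (prim_expr_order wN) expr1n mul1r.
  by rewrite mulnC exprM (prim_expr_order wN) expr1n invr1.
apply: (mulfI (x := v - 1)); first by rewrite subr_eq0.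
by rewrite -subrX1 vN subrr mulr0.
Qed.

Lemma prim_root_norm N (w : C) : N.-primitive_root w -> `|w| = 1.
Proof.
move=> wN; have := congr1 Num.norm (prim_expr_order wN).
rewrite normrX normr1 => /eqP.
by rewrite pexpr_eq1 ?normr_ge0 // -?lt0n ?(prim_order_gt0 wN) // => /eqP.
Qed.

Definition omega (N : nat) : C := xchoose (prim_root_exists C (ltn0Sn N)).

Lemma omegaP N : N.+1.-primitive_root (omega N).
Proof. exact: (xchooseP (prim_root_exists C (ltn0Sn N))). Qed.

Lemma norm_omegaX N j : `|omega N ^+ j| = 1.
Proof. by rewrite normrX (prim_root_norm (omegaP N)) expr1n. Qed.

(** Up to the factor [1 / M] this is the Fejér kernel, a squared modulus. *)
Lemma fejer_ge0 M (z : C) : `|z| = 1 ->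
  0 <= \sum_(a < M) \sum_(b < M) chi b a z.
Proof.
move=> z1.
have -> : \sum_(a < M) \sum_(b < M) chi b a z = `|\sum_(b < M) z ^+ b| ^+ 2.
  rewrite sqr_normc rmorph_sum big_distrlr /= exchange_big /=.
  apply: eq_bigr => b _; apply: eq_bigr => a _.
  by have := conj_chi a 0 z1; rewrite /chi expr0 divr1 mul1r => ->.
exact: exprn_ge0.
Qed.

End RootsOfUnity.

(** * Orthogonality of the generators, words, and homogeneous elements as matrices *)

Section Cuntz.
Context {R : realType} {O : cstarAlg R} {n : nat} {S : 'I_n -> O}.
Hypothesis cS : cuntz_algebra S.
Implicit Types (p q x y : O) (a b c d : nat).

Lemma cuntz_iso i : star (S i) * S i = 1.
Proof. exact: (cuntz_isometry cS). Qed.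

(** With [h i = S_j^* S_i S_i^* S_j], the elements [1 - 2 h i] have norm at most
    [1] and the [h i] with [i != j] sum to [0], so both [1 + t h i] and
    [1 - t h i] lie in the unit ball for some [t > 0] and [h i = 0]. *)
Lemma cuntz_orth i j : i != j -> star (S i) * S j = 0.
Proof.
move=> ij; pose h k : O := star (S j) * (S k * star (S k)) * S j.
have hs k : star (h k) = h k by rewrite /h !starM !starK !mulrA.
have h2 k : rnorm (1 - (h k + h k)) <= 1.
  have -> : 1 - (h k + h k) =
      star (S j) * (1 - (S k * star (S k) + S k * star (S k))) * S j.
    by rewrite mulrBr mulrBl mulr1 cuntz_iso mulrDr mulrDl.
  set u : O := 1 - _.
  (* [u] is a self-adjoint unitary, because [S k * star (S k)] is a projection. *)
  have u1 : rnorm u = 1.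
    apply: rnorm_isometry; rewrite /u starD starN star1 starD starM starK.
    set e := S k * _; have ee : e * e = e.
      by rewrite /e mulrA -(mulrA (S k)) cuntz_iso mulr1.
    rewrite mulrBr mulr1 mulrBl mul1r mulrDl !mulrDr !ee.
    by set f := e + e; rewrite opprB addrK subrK.
  apply: le_trans (rnormM _ _) _; rewrite (rnorm_isometry (cuntz_iso j)) mulr1.
  apply: le_trans (rnormM _ _) _; rewrite u1 mulr1 rnorm_star.
  by rewrite (rnorm_isometry (cuntz_iso j)).
have hj : h j = 1 by rewrite /h mulrA cuntz_iso mul1r cuntz_iso.
have hsum : \sum_(k | k != j) h k = 0.
  have : \sum_k h k = h j.
    by rewrite -mulr_suml -mulr_sumr (cuntz_sum cS) mulr1 cuntz_iso hj.
  by rewrite (bigD1 j) //= => hsum; apply: (addrI (h j)); rewrite addr0.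
rewrite (bigD1 i) //= in hsum.
pose D := [pred k | (k != j) && (k != i)].
(* Both [m + 2 h i = 1 + \sum_(k | D k) (1 - 2 h k)] and [m - 2 h i = (1 - 2 h i) + \sum_(k | D k)
   1] are sums of [m] elements of norm at most 1. *)
pose m : R := 1 + #|D|%:R; have m0 : 0 < m by rewrite ltr_pwDl.
pose g : O := (m^-1)%:C *: (h i + h i).
have gs : star g = g by rewrite star_real starD hs.
have mE x : 1 + (m^-1)%:C *: x = (m^-1)%:C *: (m%:C%:A + x).
  by rewrite scalerDr scalerA -rmorphM /= mulVf ?gt_eqF // scale1r.
have mA : m%:C%:A = 1 + \sum_(k | D k) (1 : O).
  rewrite sumr_const /m rmorphD rmorph_nat /= scalerDl scale1r.
  by rewrite scaler_nat.
have gle (x : O) : rnorm (m%:C%:A + x) <= m -> rnorm (1 + (m^-1)%:C *: x) <= 1.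
  move=> xm; rewrite mE rnormZr ?invr_ge0 ?(ltW m0) // mulrC.
  by rewrite ler_pdivrMr // mul1r.
have cardD : \sum_(k | D k) (1 : R) = #|D|%:R by rewrite sumr_const.
have g0 : g = 0.
  apply: extreme_one => //.
    apply: gle; rewrite mA -addrA.
    have -> : \sum_(k | D k) 1 + (h i + h i) = \sum_(k | D k) (1 - (h k + h k)).
      have hi : h i = - \sum_(k | D k) h k by apply/eqP; rewrite -addr_eq0 hsum.
      by rewrite sumrB big_split /= {1 2}hi -opprD.
    apply: le_trans (rnormD _ _) _; rewrite rnorm1 lerD2l.
    apply: le_trans (rnorm_sum _ _ _) _; rewrite -cardD; exact: ler_sum.
  rewrite -scalerN; apply: gle; rewrite mA addrAC.
  apply: le_trans (rnormD _ _) _; apply: lerD; first exact: h2.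
  apply: le_trans (rnorm_sum _ _ _) _; rewrite -cardD.
  by apply: ler_sum => k _; rewrite rnorm1.
have hi0 : h i = 0.
  rewrite -[h i]half2; move/(congr1 (fun x => m%:C *: x)): g0.
  rewrite /g scalerA -rmorphM /= mulfV ?gt_eqF // scale1r scaler0 => ->.
  by rewrite scaler0.
(* [h i] is [star t * t] for [t = star (S i) * S j]. *)
apply: rnorm_eq0; apply/eqP; rewrite -sqrf_eq0 -rnorm_starM starM starK.
by rewrite -mulrA (mulrA (S i)) mulrA -/(h i) hi0 rnorm0.
Qed.

Fixpoint word a : finType :=
  if a is a'.+1 then (word a' * 'I_n)%type else unit.

Fixpoint word_elt a : word a -> O :=
  match a with
  | 0 => fun=> 1
  | a'.+1 => fun w => word_elt w.1 * S w.2
  end.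
Local Notation W := word_elt.

Lemma card_word a : #|word a| = (n ^ a)%N.
Proof.
elim: a => [|a IH]; first exact: card_unit.
by rewrite card_prod card_ord IH expnSr.
Qed.

Lemma word_orth a (u v : word a) : star (W u) * W v = if u == v then 1 else 0.
Proof.
elim: a u v => [|a IH] /= => [[] []|[u i] [v j]].
  by rewrite star1 mulr1.
rewrite /= starM -mulrA (mulrA (star (W u))) IH xpair_eqE.
case: (u == v); last by rewrite mul0r mulr0.
rewrite mul1r /=; case: eqVneq => [->|/cuntz_orth //]; exact: cuntz_iso.
Qed.

Lemma word_sum a : \sum_(w : word a) W w * star (W w) = 1.
Proof.
elim: a => [|a IH] /=.
  rewrite (bigD1 tt) //= big1 ?addr0 ?star1 ?mulr1 //; by case.
rewrite -(pair_bigA _ (fun u i => W u * S i * star (W u * S i))) /= -IH.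
apply: eq_bigr => u _; under eq_bigr => i _ do
  rewrite starM -mulrA (mulrA (S i)).
by rewrite -mulr_sumr -mulr_suml (cuntz_sum cS) mul1r.
Qed.

(** The span of the [W u * star (W v)] with [u] of length [a] and [v] of length
    [b], described through the matrix coefficients. *)
Definition homog a b p :=
  forall (u : word a) (v : word b), scalars O (star (W u) * p * W v).

Lemma scalars0 : scalars O 0.
Proof. by exists 0 => //; rewrite scale0r. Qed.

Lemma scalars1 : scalars O 1.
Proof. by exists 1 => //; rewrite scale1r. Qed.

Lemma scalarsD x y : scalars O x -> scalars O y -> scalars O (x + y).
Proof. by move=> [k _ <-] [l _ <-]; exists (k + l) => //; rewrite scalerDl. Qed.

Lemma scalarsM x y : scalars O x -> scalars O y -> scalars O (x * y).
Proof.
by move=> [k _ <-] [l _ <-]; exists (k * l) => //; rewrite -scalerAl mul1r scalerA.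
Qed.

Lemma scalars_star x : scalars O x -> scalars O (star x).
Proof. by move=> [k _ <-]; exists (conjc k) => //; rewrite starZ star1. Qed.

Lemma scalars_comm x y : scalars O x -> x * y = y * x.
Proof. by move=> [k _ <-]; rewrite -scalerAl -scalerAr mul1r mulr1. Qed.

Lemma scalarsZ k x : scalars O x -> scalars O (k *: x).
Proof. by move=> [l _ <-]; exists (k * l) => //; rewrite scalerA. Qed.

Lemma homog0 a b : homog a b 0.
Proof. by move=> u v; rewrite mulr0 mul0r; apply: scalars0. Qed.

Lemma homogD a b p q : homog a b p -> homog a b q -> homog a b (p + q).
Proof. by move=> hp hq u v; rewrite mulrDr mulrDl; apply: scalarsD. Qed.

Lemma homogZ a b k p : homog a b p -> homog a b (k *: p).
Proof.
by move=> hp u v; rewrite -scalerAr -scalerAl; apply: scalarsZ.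
Qed.

Lemma homog_star a b p : homog a b p -> homog b a (star p).
Proof.
by move=> hp u v; have := scalars_star (hp v u); rewrite !starM starK mulrA.
Qed.

(** Matrix multiplication: the resolution of the unit by words of length [b] is inserted between the
    factors. *)
Lemma homogM a b c p q : homog a b p -> homog b c q -> homog a c (p * q).
Proof.
move=> hp hq u v; rewrite -[p]mulr1 -(word_sum b) mulr_sumr mulr_suml.
rewrite mulr_sumr mulr_suml; elim/big_ind: _ => [||w _].
- exact: scalars0.
- exact: scalarsD.
- by have := scalarsM (hp u w) (hq w v); rewrite !mulrA.
Qed.

(** In matrix terms [p] becomes its tensor product with the identity of size [n]. Word lengths can
    thus be adjusted while [a - b] is kept. *)
Lemma homogS a b p : homog a b p -> homog a.+1 b.+1 p.
Proof.
move=> hp [u i] [v j] /=.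
have -> : star (W u * S i) * p * (W v * S j) =
  star (S i) * (star (W u) * p * W v) * S j by rewrite starM !mulrA.
have [k _ <-] := hp u v; rewrite -scalerAr mulr1 -scalerAl; apply: scalarsZ.
by have [->|/cuntz_orth ->] := eqVneq i j;
  rewrite ?cuntz_iso; [exact: scalars1 | exact: scalars0].
Qed.

Lemma homog_addr t a b p : homog a b p -> homog (a + t) (b + t) p.
Proof.
by move=> hp; elim: t => [|t IH]; rewrite ?addn0 // !addnS; apply: homogS.
Qed.

Lemma homog_gen i : homog 1 0 (S i).
Proof.
move=> [[] j] [] /=; rewrite mul1r mulr1.
by have [->|/cuntz_orth ->] := eqVneq j i;
  rewrite ?cuntz_iso; [exact: scalars1 | exact: scalars0].
Qed.

Lemma homog_expand a b p : p =
  \sum_(u : word a) \sum_(v : word b) W u * (star (W u) * p * W v) * star (W v).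
Proof.
rewrite -[LHS]mul1r -[LHS]mulr1 -{1}(word_sum a) -(word_sum b) !mulr_suml.
apply: eq_bigr => u _; rewrite mulr_sumr; apply: eq_bigr => v _.
by rewrite !mulrA.
Qed.

(** [x] is a row vector killed by the [n ^ a] by [n ^ b] matrix of [p]. *)
Lemma homog_kernel a b p : (1 < n)%N -> (b < a)%N -> homog a b p ->
  exists2 x, x != 0 & x * p = 0.
Proof.
move=> n1 ba hp.
have [C CE] : exists C : 'M[R[i]]_(#|word a|, #|word b|), forall i j,
    star (W (enum_val i)) * p * W (enum_val j) = (C i j)%:A.
  have H (ij : 'I_#|word a| * 'I_#|word b|) : exists k : R[i],
      star (W (enum_val ij.1)) * p * W (enum_val ij.2) = k%:A.
    by have [k _ <-] := hp (enum_val ij.1) (enum_val ij.2); exists k.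
  have [f fE] := choice H.
  by exists (\matrix_(i, j) f (i, j)) => i j; rewrite mxE -fE.
have : (kermx C != 0).
  rewrite -mxrank_eq0 mxrank_ker subn_eq0 -ltnNge.
  apply: leq_ltn_trans (rank_leq_col C) _.
  by rewrite !card_word ltn_exp2l.
case/rowV0Pn => d /sub_kermxP dC d0.
pose x : O := \sum_i d 0 i *: star (W (enum_val i)).
have xW j : x * W (enum_val j) = (d 0 j)%:A.
  rewrite /x mulr_suml (bigD1 j) //= -scalerAl word_orth eqxx.
  rewrite big1 ?addr0 // => i ij; rewrite -scalerAl word_orth.
  by rewrite (inj_eq enum_val_inj) (negbTE ij) scaler0.
exists x.
  apply: contraNneq d0 => x0; apply/eqP/matrixP => i j; rewrite ord1 mxE.
  have := xW j; rewrite x0 mul0r => /(congr1 (fun y : O => `|y|)).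
  rewrite normr0 normrZ => /esym/eqP; rewrite mulf_eq0 => /orP[/eqP/normr0_eq0 //|].
  by rewrite normr_eq0 oner_eq0.
(* [x * p] is recovered from the products [x * p * W v], which are the entries of [d *m C]. *)
rewrite -[x * p]mulr1 -(word_sum b) mulr_sumr big1 // => v _.
rewrite mulrA (_ : x * p * W v = 0) ?mul0r //.
rewrite -[v]enum_rankK /x !mulr_suml.
have := congr1 (fun M : 'rV_#|word b| => (M 0 (enum_rank v))%:A : O) dC.
rewrite !mxE scale0r scaler_suml => {2}<-.
by apply: eq_bigr => i _; rewrite -!scalerAl CE scalerA.
Qed.

End Cuntz.

(** * Degrees, density of polynomials, and spectral components *)

Section Gauge.
Context {R : realType} {O : cstarAlg R} {n : nat} {S : 'I_n -> O}.
Context {gamma : R[i] -> O -> O}.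
Hypotheses (cS : cuntz_algebra S) (gS : gauge_action S gamma).
Implicit Types (p q x y : O) (a b c d t N M : nat) (z : R[i]).

Local Notation homog := (@homog R O n S).
Local Notation word := (@word n).
Local Notation W := (@word_elt R O n S _).

Lemma gaugeD z x y : `|z| = 1 -> gamma z (x + y) = gamma z x + gamma z y.
Proof. by move=> /(gauge_aut gS)/star_automorphismD. Qed.

Lemma gauge0 z : `|z| = 1 -> gamma z 0 = 0.
Proof. by move=> /(gauge_aut gS)/star_automorphism0. Qed.

Lemma gaugeZ z k x : `|z| = 1 -> gamma z (k *: x) = k *: gamma z x.
Proof. by move=> /(gauge_aut gS)/star_automorphismZ. Qed.

Lemma gaugeB z x y : `|z| = 1 -> gamma z (x - y) = gamma z x - gamma z y.
Proof. by move=> z1; rewrite gaugeD // -scaleN1r gaugeZ // scaleN1r. Qed.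

Lemma gauge_mul z x y : `|z| = 1 -> gamma z (x * y) = gamma z x * gamma z y.
Proof. by move=> /(gauge_aut gS)[_ [_ ->]]. Qed.

Lemma gauge_star z x : `|z| = 1 -> gamma z (star x) = star (gamma z x).
Proof. by move=> /(gauge_aut gS)[_ _ ->]. Qed.

Lemma gauge_sum z (I : Type) (r : seq I) (P : pred I) (F : I -> O) : `|z| = 1 ->
  gamma z (\sum_(i <- r | P i) F i) = \sum_(i <- r | P i) gamma z (F i).
Proof.
by move=> z1; apply: big_morph => [x y|]; [apply: gaugeD | apply: gauge0].
Qed.

Lemma gauge_bound z x : `|z| = 1 -> rnorm (gamma z x) <= 2 * rnorm x.
Proof. by move=> z1; apply/star_automorphism_bound/(gauge_aut gS). Qed.

Definition has_degree a b y := forall z, `|z| = 1 -> gamma z y = chi a b z *: y.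

Lemma gauge_word z a (u : word a) : `|z| = 1 -> gamma z (W u) = z ^+ a *: W u.
Proof.
move=> z1; elim: a u => [|a IH] u /=.
  by have [_ [-> _] _ _] := gauge_aut gS z1; rewrite expr0 scale1r.
rewrite gauge_mul // IH (gauge_gen gS) // -scalerAl -scalerAr scalerA.
by rewrite exprSr.
Qed.

Lemma homog_degree a b p : homog a b p -> has_degree a b p.
Proof.
move=> hp z z1.
rewrite [p in LHS](homog_expand cS a b) [p in RHS](homog_expand cS a b).
rewrite gauge_sum // scaler_sumr; apply: eq_bigr => u _.
rewrite gauge_sum // scaler_sumr; apply: eq_bigr => v _.
have [k _ <-] := hp u v.
rewrite !gauge_mul // gauge_star // !gauge_word // gaugeZ //.
have [_ [-> _] _ _] := gauge_aut gS z1; rewrite starZ.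
rewrite -!scalerAl -[W u * _ * (_ *: _)]scalerAr scalerA; congr (_ *: _).
by have := conj_chi b 0 z1; rewrite /chi !expr0 divr1 mul1r => ->.
Qed.

(** The star-algebra spanned by the [W u * star (W v)], presented as lists of homogeneous summands
    to allow induction. *)
Inductive cuntz_poly : O -> Prop :=
| CuntzPoly0 : cuntz_poly 0
| CuntzPolyD a b x p : homog a b x -> cuntz_poly p -> cuntz_poly (x + p).

Lemma cuntz_poly_homog a b p : homog a b p -> cuntz_poly p.
Proof.
by move=> hp; rewrite -[p]addr0; apply: (CuntzPolyD hp); apply: CuntzPoly0.
Qed.

Lemma cuntz_polyD p q : cuntz_poly p -> cuntz_poly q -> cuntz_poly (p + q).
Proof.
move=> pp pq; elim: pp => [|a b x p' hx _ IH]; first by rewrite add0r.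
by rewrite -addrA; apply: (CuntzPolyD hx).
Qed.

Lemma cuntz_polyZ k p : cuntz_poly p -> cuntz_poly (k *: p).
Proof.
elim=> [|a b x p' hx _ IH]; first by rewrite scaler0; apply: CuntzPoly0.
by rewrite scalerDr; apply: (CuntzPolyD (homogZ k hx)).
Qed.

Lemma cuntz_poly_star p : cuntz_poly p -> cuntz_poly (star p).
Proof.
elim=> [|a b x p' hx _ IH]; first by rewrite star0; apply: CuntzPoly0.
by rewrite starD; apply: (CuntzPolyD (homog_star hx)).
Qed.

Lemma cuntz_polyM p q : cuntz_poly p -> cuntz_poly q -> cuntz_poly (p * q).
Proof.
move=> pp pq; elim: pp => [|a b x p' hx _ IH].
  by rewrite mul0r; apply: CuntzPoly0.
rewrite mulrDl; apply: cuntz_polyD IH.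
elim: pq => [|c d y q' hy _ IH]; first by rewrite mulr0; apply: CuntzPoly0.
rewrite mulrDr; apply: cuntz_polyD IH.
apply: (@cuntz_poly_homog (a + c) (d + b)).
(* Padding the left factor by [c] and the right one by [b] makes both inner lengths [b + c]. *)
apply: (@homogM _ _ _ _ cS _ (b + c)); first exact: homog_addr.
by rewrite [(b + c)%N]addnC; apply: homog_addr.
Qed.

(** The elements that polynomials approximate form a C*-subalgebra containing the generators, hence
    all of [O]. *)
Lemma cuntz_poly_dense x (e : R) : 0 < e ->
  exists2 p, cuntz_poly p & rnorm (x - p) < e.
Proof.
pose D : set O := [set x | forall e : R, 0 < e ->
  exists2 p, cuntz_poly p & rnorm (x - p) < e].
suff Dx : D x by exact: Dx.
have polyD p : cuntz_poly p -> D p.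
  by move=> pp f f0; exists p; rewrite // subrr rnorm0.
suff : cstar_generated (range S) `<=` D.
  by rewrite (cuntz_generated cS); apply.
apply: smallest_sub; last first.
  by move=> _ [i _ <-]; apply/polyD/cuntz_poly_homog/(homog_gen cS).
split.
- exact/polyD/CuntzPoly0.
- move=> u v Du Dv f f0; have f20 : 0 < f / 2 by rewrite divr_gt0.
  have [p pp up] := Du _ f20; have [q pq vq] := Dv _ f20.
  exists (p + q); first exact: cuntz_polyD.
  rewrite opprD addrACA; apply: le_lt_trans (rnormD _ _) _; lra.
- move=> k u Du f f0; set m := complex.Re `|k|.
  have m0 : 0 <= m by rewrite -ler0c RRe_real ?normr_real ?normr_ge0.
  have [|p pp up] := Du (f / (m + 1)); first by rewrite divr_gt0 // ltr_wpDl.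
  exists (k *: p); first exact: cuntz_polyZ.
  rewrite -scalerBr rnormZ -/m; move: up; rewrite ltr_pdivlMr ?ltr_wpDl //.
  by apply: le_lt_trans; rewrite mulrC ler_wpM2l ?rnorm_ge0 // lerDl.
- move=> u v Du Dv f f0.
  have v0 := rnorm_ge0 v; have u0 := rnorm_ge0 u.
  have c0 : 0 < rnorm u + rnorm v + 1 by lra.
  (* Since [g <= 1], the error [g * rnorm v + (rnorm u + g) * g] is at most
     [g * (rnorm u + rnorm v + 1)]. *)
  pose g := Num.min 1 (f / (rnorm u + rnorm v + 1)).
  have g0 : 0 < g by rewrite lt_min ltr01 divr_gt0.
  have g1 : g <= 1 by rewrite ge_min lexx.
  have gf : g * (rnorm u + rnorm v + 1) <= f.
    by rewrite -ler_pdivlMr // ge_min lexx orbT.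
  have [p pp up] := Du _ g0; have [q pq vq] := Dv _ g0.
  exists (p * q); first exact: cuntz_polyM.
  have -> : u * v - p * q = (u - p) * v + p * (v - q).
    by rewrite mulrBl mulrBr addrA subrK.
  have pn : rnorm p <= rnorm u + g.
    have := rnormB u (u - p); rewrite subKr; lra.
  apply: le_lt_trans (rnormD _ _) _.
  have := rnormM (u - p) v; have := rnormM p (v - q).
  have := rnorm_ge0 p; have := rnorm_ge0 (v - q); have := rnorm_ge0 (u - p).
  nra.
- move=> u Du f f0; have [p pp up] := Du _ f0.
  exists (star p); first exact: cuntz_poly_star.
  by rewrite -starN -starD rnorm_star.
- apply: rnorm_closed => u Hu f f0; have f20 : 0 < f / 2 by rewrite divr_gt0.
  have [v Dv uv] := Hu _ f20; have [p pp vp] := Dv _ f20.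
  exists p => //; rewrite -(subrK v u) -addrA.
  apply: le_lt_trans (rnormD _ _) _; lra.
Qed.

(** The average of [chi b a z *: gamma z x] over the [N.+1]-st roots of unity
    extracts the part of degree [a - b] modulo [N.+1]. *)
Definition fcoef a b N x : O :=
  (N.+1%:R^-1 : R)%:C *:
    \sum_(j < N.+1) chi b a (omega N ^+ j) *: gamma (omega N ^+ j) x.

Lemma fcoefD a b N x y : fcoef a b N (x + y) = fcoef a b N x + fcoef a b N y.
Proof.
rewrite /fcoef -scalerDr -big_split; congr (_ *: _); apply: eq_bigr => j _ /=.
by rewrite gaugeD ?norm_omegaX // scalerDr.
Qed.

Lemma fcoefB a b N x y : fcoef a b N (x - y) = fcoef a b N x - fcoef a b N y.
Proof.
rewrite /fcoef -scalerBr -sumrB; congr (_ *: _); apply: eq_bigr => j _ /=.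
by rewrite gaugeB ?norm_omegaX // scalerBr.
Qed.

Lemma fcoef0 a b N : fcoef a b N 0 = 0.
Proof. by rewrite -[X in fcoef _ _ _ X](subrr 0) fcoefB subrr. Qed.

Lemma fcoef_bound a b N x : rnorm (fcoef a b N x) <= 2 * rnorm x.
Proof.
rewrite rnormZr ?invr_ge0 // mulrC ler_pdivrMr ?ltr0n //.
apply: le_trans (rnorm_sum _ _ _) _.
apply: le_trans (_ : \sum_(j < N.+1) 2 * rnorm x <= _).
  apply: ler_sum => j _; rewrite rnormZ1 ?norm_chi ?norm_omegaX //.
  by rewrite gauge_bound ?norm_omegaX.
by rewrite sumr_const card_ord mulr_natr.
Qed.

(** The two bounds keep the exponents below the order [N.+1] of the root, so that congruent
    exponents are equal. *)
Lemma fcoef_degree a b c d N y : has_degree c d y ->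
  (b + c <= N)%N -> (a + d <= N)%N ->
  fcoef a b N y = if (b + c == a + d)%N then y else 0.
Proof.
move=> dy bc ad; rewrite /fcoef.
under eq_bigr => j _ do rewrite dy ?norm_omegaX // scalerA chiM.
rewrite -scaler_suml (sum_chi (omegaP N)) ?ltnS //.
case: ifP => _; last by rewrite scale0r scaler0.
rewrite scalerA -(rmorph_nat (real_complex R)) -rmorphM /= mulVf ?pnatr_eq0 //.
by rewrite scale1r.
Qed.

(** For [N] large no two distinct degrees are confused. Then [q] collects the summands of degree
    [a - b], padded to common lengths. *)
Lemma fcoef_poly a b p : cuntz_poly p -> exists t q, homog (a + t) (b + t) q /\
  exists N0, forall N, (N0 <= N)%N -> fcoef a b N p = q.
Proof.
elim=> [|c d x p' hx _ [t [q [hq [N0 H]]]]].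
  exists 0, 0; split; first exact: homog0.
  by exists 0 => N _; rewrite fcoef0.
exists (t + c)%N, ((if (b + c == a + d)%N then x else 0) + q).
split; last first.
  exists (maxn N0 (a + b + c + d)) => N; rewrite geq_max => /andP[N0N abN].
  rewrite fcoefD H // (fcoef_degree (homog_degree hx)) //; lia.
rewrite !addnA; apply: homogD; last exact: homog_addr.
case: eqP => [e|_]; last exact: homog0.
have := @homog_addr _ _ _ _ cS (a + t) _ _ _ hx.
rewrite (_ : (c + (a + t) = a + t + c)%N); last by lia.
by rewrite (_ : (d + (a + t) = b + t + c)%N); last by lia.
Qed.

Definition fcoef_lim a b x y := forall e : R, 0 < e ->
  exists N0, forall N, (N0 <= N)%N -> rnorm (fcoef a b N x - y) < e.

(** Cauchy: the averages of a nearby polynomial are eventually constant, and [fcoef_bound] is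
    uniform in [N]. *)
Lemma fcoef_cvg a b x : exists y, fcoef_lim a b x y.
Proof.
apply: (@rnorm_complete _ _ (fun N => fcoef a b N x)) => e e0.
have [|p pp xp] := @cuntz_poly_dense x (e / 4); first by rewrite divr_gt0.
have [t [q [_ [N0 H]]]] := fcoef_poly a b pp.
exists N0 => k m Nk Nm.
have -> : fcoef a b k x - fcoef a b m x = fcoef a b k (x - p) - fcoef a b m (x - p).
  by rewrite !fcoefB !H // opprB addrA subrK.
apply: le_lt_trans (rnormB _ _) _.
have := fcoef_bound a b k (x - p); have := fcoef_bound a b m (x - p); lra.
Qed.

Lemma fcoef_lim_homog a b x y : fcoef_lim a b x y -> forall e : R, 0 < e ->
  exists t q, homog (a + t) (b + t) q /\ rnorm (y - q) < e.
Proof.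
move=> xy e e0.
have [|p pp xp] := @cuntz_poly_dense x (e / 4); first by rewrite divr_gt0.
have [t [q [hq [N0 H]]]] := fcoef_poly a b pp.
have [|N1 H1] := xy (e / 2); first by rewrite divr_gt0.
exists t, q; split => //.
have := H1 _ (leq_maxr N0 N1); set N := maxn N0 N1 => yN.
have -> : y - q = fcoef a b N (x - p) - (fcoef a b N x - y).
  by rewrite fcoefB H ?leq_maxl // opprB [RHS]addrC addrA subrK.
apply: le_lt_trans (rnormB _ _) _.
have := fcoef_bound a b N (x - p); lra.
Qed.

Lemma fcoef_lim_degree a b x y : fcoef_lim a b x y -> has_degree a b y.
Proof.
move=> xy z z1; apply: (@rnorm_sub_small _ _ 3) => e e0.
have [t [q [hq yq]]] := fcoef_lim_homog xy e0.
have -> : gamma z y - chi a b z *: y =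
    gamma z (y - q) - chi a b z *: (y - q).
  rewrite gaugeB // (homog_degree hq) //.
  rewrite (@chi_eq _ (a + t) (b + t) a b z) //; last by lia.
  by rewrite scalerBr opprB addrA subrK.
apply: le_trans (rnormB _ _) _; rewrite rnormZ1 ?norm_chi //.
have := gauge_bound (y - q) z1; lra.
Qed.

(** With [fcoef_lim_homog], this makes every element of degree [a - b] a limit of homogeneous
    ones. *)
Lemma has_degree_lim a b y : has_degree a b y -> fcoef_lim a b y y.
Proof.
move=> dy e e0; exists (a + b)%N => N abN.
rewrite (fcoef_degree dy) //; last lia.
by rewrite addnC eqxx subrr rnorm0.
Qed.

(** In positive degree, [y * star y] is not invertible: [y] is close to a matrix
    with more rows than columns. *)
Lemma has_degree_eq0 a b y : (1 < n)%N -> (b < a)%N -> has_degree a b y ->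
  scalars O (y * star y) -> y = 0.
Proof.
move=> n1 ba dy [k _ yk]; apply: rnorm_eq0; apply/eqP/negPn/negP => yn0.
have s0 : 0 < rnorm y by rewrite lt_def yn0 rnorm_ge0.
have [|t [q [hq yq]]] := @fcoef_lim_homog _ _ _ _ (has_degree_lim dy) (rnorm y / 4).
  by rewrite divr_gt0.
have [|x x0 xq] := homog_kernel cS n1 _ hq; first by rewrite ltn_add2r.
have xp : 0 < rnorm x.
  by rewrite lt_def rnorm_ge0 andbT; apply: contraNneq x0 => /rnorm_eq0 ->.
have e1 : rnorm (x * (y * star y)) = rnorm y ^+ 2 * rnorm x.
  have <- : complex.Re `|k| = rnorm y ^+ 2.
    by rewrite -(rnorm_star y) -rnorm_starM starK -yk rnorm_alg.
  by rewrite -yk -scalerAr mulr1 rnormZ.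
(* The difference of [y * star y] and [q * star q] is small, and [x] kills the latter. *)
have e2 : x * (y * star y) = x * ((y - q) * star y + q * star (y - q)).
  rewrite starD starN mulrBl mulrBr addrA subrK mulrBr [x * (q * _)]mulrA xq.
  by rewrite mul0r subr0.
have := rnormM x ((y - q) * star y + q * star (y - q)); rewrite -e2 e1 mulrC.
rewrite ler_pM2l //; have := rnormD ((y - q) * star y) (q * star (y - q)).
have := rnormM (y - q) (star y); have := rnormM q (star (y - q)).
rewrite !rnorm_star.
have qn : rnorm q <= rnorm y + rnorm (y - q).
  by have := rnormB y (y - q); rewrite subKr.
have := rnorm_ge0 (y - q); have := rnorm_ge0 q.
set u := rnorm (y - q) in yq qn *; set s := rnorm y in s0 yq qn *.
set v := rnorm q in qn *.
move=> v0 u0 h1 h2 h3 h4.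
(* From [s * s <= u * s + v * u] and [u < s / 4] one would get [s * s <= (9 / 16) * (s * s)]. *)
have h5 : v * u <= (s + u) * u by rewrite ler_wpM2r.
have h6 : u * s <= s / 4 * s by rewrite ler_wpM2r // ltW.
have h7 : u * u <= s / 4 * (s / 4) by apply: ler_pM => //; apply: ltW.
have h8 : 0 < s * s by rewrite mulr_gt0.
have := le_trans h4 (le_trans h3 (lerD h2 h1)); rewrite expr2.
by clear -h5 h6 h7 h8; lra.
Qed.

(** * Fejér means and uniqueness of spectral components *)

Lemma sum_ltn M c : (\sum_(a < M) (a < c) <= c)%N.
Proof.
suff -> : (\sum_(a < M) (a < c) = minn M c)%N by apply: geq_minr.
elim: M => [|M IH]; first by rewrite big_ord0 min0n.
by rewrite big_ord_recr /= IH; case: ltnP; lia.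
Qed.

(** For given [a] the only candidate is [b = a + d - c]. It leaves the range only if [a < c] or
    [M <= a + d], which excludes at most [c + d] values of [a]. *)
Lemma sum_shift_eq M c d :
  let k := (\sum_(a < M) \sum_(b < M) (b + c == a + d))%N in
  (k <= M)%N /\ (M <= k + (c + d))%N.
Proof.
have fE (a : 'I_M) : (\sum_(b < M) (b + c == a + d) = (c <= a + d < M + c))%N.
  have [/andP[ca aM]|nca] := boolP (c <= a + d < M + c)%N.
    have aM' : (a + d - c < M)%N by lia.
    rewrite (bigD1 (Ordinal aM')) //= subnK // eqxx big1 // => b bM.
    apply/eqP; rewrite eqb0; apply: contra bM => /eqP e.
    by apply/eqP/val_inj => /=; lia.
  rewrite big1 // => b _; apply/eqP; rewrite eqb0; apply: contra nca => /eqP e.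
  by have := ltn_ord b; lia.
rewrite /=; under eq_bigr => a _ do rewrite fE.
have M1 : (\sum_(a < M) 1 = M)%N by rewrite sum1_card card_ord.
split; first by rewrite -[X in (_ <= X)%N]M1; apply: leq_sum => a _; apply: leq_b1.
have s2 : (\sum_(a < M) (M <= a + d) <= d)%N.
  rewrite (reindex_inj rev_ord_inj) /=; apply: leq_trans (sum_ltn M d).
  by apply: leq_sum => a _; have := ltn_ord a; lia.
apply: leq_trans (leq_add (leqnn _) (leq_add (sum_ltn M c) s2)).
rewrite -big_split -big_split /= -[X in (X <= _)%N]M1; apply: leq_sum => a _; lia.
Qed.

(** Grouping the pairs by [k = a - b] gives the component of degree [k] the weight [1 - |k| / M]: a
    Cesàro mean of Fourier sums. *)
Definition fejer M N x : O :=
  (M%:R^-1 : R)%:C *: \sum_(a < M) \sum_(b < M) fcoef a b N x.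

Lemma fejerD M N x y : fejer M N (x + y) = fejer M N x + fejer M N y.
Proof.
rewrite /fejer -scalerDr -big_split; congr (_ *: _); apply: eq_bigr => a _ /=.
by rewrite -big_split; apply: eq_bigr => b _ /=; rewrite fcoefD.
Qed.

Lemma fejerB M N x y : fejer M N (x - y) = fejer M N x - fejer M N y.
Proof. by apply/eqP; rewrite eq_sym subr_eq -fejerD subrK. Qed.

(** A mean of the [gamma z x] with nonnegative weights of total 1, hence a bound independent of [M].
    Orthogonality of the characters involved asks for [M <= N.+1]. *)
Lemma fejer_bound M N x : (0 < M)%N -> (M <= N.+1)%N ->
  rnorm (fejer M N x) <= 2 * rnorm x.
Proof.
move=> M0 MN; rewrite rnormZr ?invr_ge0 // mulrC ler_pdivrMr ?ltr0n //.
pose K z := \sum_(a < M) \sum_(b < M) chi b a z : R[i].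
pose k (j : 'I_N.+1) := complex.Re (K (omega N ^+ j)).
have K0 (j : 'I_N.+1) : 0 <= K (omega N ^+ j) by apply/fejer_ge0/norm_omegaX.
have kE j : (k j)%:C = K (omega N ^+ j) by apply/RRe_real/ger0_real/K0.
have k0 j : 0 <= k j by rewrite -ler0c kE.
have -> : \sum_(a < M) \sum_(b < M) fcoef a b N x = (N.+1%:R^-1 : R)%:C *:
    \sum_(j < N.+1) (k j)%:C *: gamma (omega N ^+ j) x.
  under eq_bigr => a _ do rewrite -scaler_sumr exchange_big /=.
  rewrite -scaler_sumr exchange_big /=; congr (_ *: _); apply: eq_bigr => j _.
  rewrite kE scaler_suml; apply: eq_bigr => a _.
  by rewrite scaler_suml.
have ksum : \sum_(j < N.+1) k j = M%:R * N.+1%:R.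
  apply: complexI; rewrite rmorph_sum /=; under eq_bigr => j _ do rewrite kE.
  rewrite /K exchange_big /= rmorphM !rmorph_nat mulr_natl.
  transitivity (\sum_(a < M) N.+1%:R : R[i]); last first.
    by rewrite sumr_const card_ord.
  apply: eq_bigr => a _.
  rewrite exchange_big /=; under eq_bigr => b _ do
    rewrite (sum_chi (omegaP N)) ?(leq_trans (ltn_ord _) MN) //.
  rewrite (bigD1 a) //= eqxx big1 ?addr0 // => b ba.
  by rewrite (inj_eq val_inj) (negbTE ba).
rewrite rnormZr ?invr_ge0 // mulrC ler_pdivrMr ?ltr0n //.
apply: le_trans (rnorm_sum _ _ _) _.
apply: le_trans (_ : \sum_(j < N.+1) k j * (2 * rnorm x) <= _).
  apply: ler_sum => j _; rewrite rnormZr // ler_wpM2l // gauge_bound //.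
  exact: norm_omegaX.
by rewrite -mulr_suml ksum mulrC mulrA.
Qed.


Lemma fejer_homog M N c d x : homog c d x -> (0 < M)%N -> (M + c + d <= N)%N ->
  rnorm (fejer M N x - x) <= (c + d)%:R * rnorm x / M%:R.
Proof.
move=> hx M0 MN; set k := (\sum_(a < M) \sum_(b < M) (b + c == a + d))%N.
have [kM Mk] := sum_shift_eq M c d; rewrite -/k in kM Mk.
have -> : fejer M N x = (M%:R^-1 : R)%:C *: ((k%:R : R)%:C *: x).
  congr (_ *: _); rewrite rmorph_nat scaler_nat /k -sumrMnr.
  apply: eq_bigr => a _; rewrite -sumrMnr; apply: eq_bigr => b _.
  have aM := ltn_ord a; have bM := ltn_ord b.
  rewrite (fcoef_degree (homog_degree hx)); [|lia..].
  by case: eqP.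
have -> : (M%:R^-1 : R)%:C *: ((k%:R : R)%:C *: x) - x =
    - (((M - k)%:R / M%:R : R)%:C *: x).
  have Mn0 : (M%:R : R) != 0 by rewrite pnatr_eq0 -lt0n.
  rewrite scalerA -rmorphM /= -{2}[x]scale1r -scalerBl -scaleNr; congr (_ *: _).
  rewrite -(rmorph1 (real_complex R)) -rmorphB -rmorphN /=; congr (_%:C).
  by rewrite natrB // mulrBl divff // opprB mulrC.
rewrite rnormN rnormZr ?divr_ge0 // mulrAC ler_pM2r ?invr_gt0 ?ltr0n //.
by rewrite ler_wpM2r ?rnorm_ge0 // ler_nat; lia.
Qed.

Lemma fejer_poly p : cuntz_poly p -> forall e : R, 0 < e ->
  exists M0, forall M, (M0 <= M)%N ->
    exists N0, forall N, (N0 <= N)%N -> rnorm (fejer M N p - p) < e.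
Proof.
elim=> [|c d x p' hx _ IH] e e0.
  exists 0%N => M _; exists 0%N => N _.
  by rewrite -{1}(subrr 0) fejerB subrr subrr rnorm0.
have e20 : 0 < e / 2 by rewrite divr_gt0.
have [M1 H] := IH _ e20.
pose C := (c + d)%:R * rnorm x.
have C0 : 0 <= C by rewrite mulr_ge0 ?rnorm_ge0.
pose M2 := (Num.Def.truncn (C / (e / 2))).+1.
exists (maxn M1 M2) => M; rewrite geq_max => /andP[M1M M2M].
have [N1 HN] := H _ M1M.
have M0 : (0 < M)%N by apply: leq_trans M2M.
exists (maxn N1 (M + c + d)) => N; rewrite geq_max => /andP[N1N MN].
rewrite fejerD opprD addrACA; apply: le_lt_trans (rnormD _ _) _.
have := HN _ N1N; have := fejer_homog hx M0 MN; rewrite -/C.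
have : C / M%:R < e / 2.
  rewrite ltr_pdivrMr ?ltr0n // mulrC -ltr_pdivrMr //.
  apply: lt_le_trans (truncnS_gt _) _; by rewrite ler_nat.
lra.
Qed.

(** With [p] a polynomial near [x], [rnorm x] is at most the sum of the norms of [x - p], of the
    mean of [x], of the mean of [x - p], and of the mean of [p] minus [p]. These cost 1, 1, 2 and 1
    times [e / 5]. *)
Lemma fcoef_eq0 x : (forall a b, fcoef_lim a b x 0) -> x = 0.
Proof.
move=> x0; apply: rnorm_small => e e0.
have e50 : 0 < e / 5 by rewrite divr_gt0.
have [p pp xp] := cuntz_poly_dense x e50.
have [M1 H] := fejer_poly pp e50.
pose M := M1.+1; have [N1 HN] := H M (leqnSn _).
have M0 : (0 : R) < M%:R by rewrite ltr0n.
have [N2 HN2] : exists N2, forall N (a b : 'I_M), (N2 <= N)%N ->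
    rnorm (fcoef a b N x) < e / 5 / M%:R.
  have eM : 0 < e / 5 / M%:R by rewrite divr_gt0.
  have [f fP] := choice (fun ab : 'I_M * 'I_M => x0 ab.1 ab.2 _ eM).
  (* [M] is fixed before [N], so only finitely many coefficients have to be small together. *)
  exists (\max_ab f ab) => N a b fN.
  have := fP (a, b) N (leq_trans (leq_bigmax (a, b)) fN).
  by rewrite subr0.
pose N := maxn M (maxn N1 N2).
have Fx : rnorm (fejer M N x) <= e / 5.
  rewrite rnormZr ?invr_ge0 // mulrC ler_pdivrMr //.
  apply: le_trans (rnorm_sum _ _ _) _.
  apply: le_trans (_ : \sum_(a < M) e / 5 <= _); last first.
    by rewrite sumr_const card_ord mulr_natr.
  apply: ler_sum => a _; apply: le_trans (rnorm_sum _ _ _) _.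
  apply: le_trans (_ : \sum_(b < M) e / 5 / M%:R <= _).
    by apply: ler_sum => b _; apply/ltW/HN2; rewrite /N; lia.
  by rewrite sumr_const card_ord -[leLHS]mulr_natr divfK // gt_eqF.
have pF : rnorm (fejer M N p - p) < e / 5 by apply: HN; rewrite /N; lia.
have Fxp : rnorm (fejer M N (x - p)) <= 2 * rnorm (x - p).
  by apply: fejer_bound; rewrite /N; lia.
have -> : x = (x - p) + (fejer M N x - fejer M N (x - p) - (fejer M N p - p)).
  by rewrite fejerB !subKr subrK.
have := rnormD (x - p) (fejer M N x - fejer M N (x - p) - (fejer M N p - p)).
have := rnormB (fejer M N x - fejer M N (x - p)) (fejer M N p - p).
have := rnormB (fejer M N x) (fejer M N (x - p)).
lra.
Qed.

(** * Spectral components of an element commuting with [A] *)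

Section Commutant.
Variable A : set O.
Hypotheses (sA : cstar_subalgebra A) (Afix : A `<=` gauge_fixed gamma).
Local Notation commutes x := (forall a : O, A a -> x * a = a * x).

(** Every [gamma z] fixes [A] pointwise, so [gamma z x] commutes with [A] whenever [x] does. *)
Lemma fcoef_commutes a b N x : commutes x -> commutes (fcoef a b N x).
Proof.
move=> xA s As; rewrite /fcoef -scalerAl -scalerAr mulr_suml mulr_sumr.
congr (_ *: _); apply: eq_bigr => j _.
rewrite -scalerAl -scalerAr; congr (_ *: _); have j1 := norm_omegaX (R := R) N j.
by rewrite -{1}(Afix As j1) -gauge_mul // xA // gauge_mul // (Afix As j1).
Qed.

Lemma fcoef_lim_commutes a b x y : commutes x -> fcoef_lim a b x y -> commutes y.
Proof.
move=> xA xy s As; apply: (@rnorm_sub_small _ _ (2 * rnorm s)) => e /xy[N HN].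
have -> : y * s - s * y =
    s * (fcoef a b N x - y) - (fcoef a b N x - y) * s.
  rewrite mulrBr mulrBl (fcoef_commutes a b N xA) //.
  by rewrite opprB [RHS]addrC addrA subrK.
apply: le_trans (rnormB _ _) _; have := HN N (leqnn N).
have := rnormM s (fcoef a b N x - y); have := rnormM (fcoef a b N x - y) s.
move=> h1 h2 /ltW/(ler_wpM2l (rnorm_ge0 s)) h3; lra.
Qed.

Hypothesis n1 : (1 < n)%N.
Hypothesis irr : relative_commutant A (gauge_fixed gamma) = scalars O.

Lemma star_commutes x : commutes x -> commutes (star x).
Proof.
move=> xA s As; have := xA _ (csub_star sA As).
by move/(congr1 (@star R O)); rewrite !starM starK => ->.
Qed.

Lemma degree_fixed a y : has_degree a a y -> gauge_fixed gamma y.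
Proof. by move=> dy z z1; rewrite dy // chi_diag // scale1r. Qed.

Lemma degree_mul_star a b y : has_degree a b y ->
  gauge_fixed gamma (y * star y).
Proof.
move=> dy z z1; rewrite gauge_mul // gauge_star // dy // starZ conj_chi //.
by rewrite -scalerAl -scalerAr scalerA chiM [(b + a)%N]addnC chi_diag // scale1r.
Qed.

Lemma degree_star a b y : has_degree a b y -> has_degree b a (star y).
Proof. by move=> dy z z1; rewrite gauge_star // dy // starZ conj_chi. Qed.

Lemma commutant_degree_gt a b y : (b < a)%N ->
  commutes y -> has_degree a b y -> y = 0.
Proof.
move=> ba yA dy; apply: (has_degree_eq0 n1 ba dy); rewrite -irr; split.
  exact: degree_mul_star dy.
by move=> s As; rewrite -mulrA star_commutes // mulrA yA // mulrA.
Qed.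

Lemma commutant_degree_neq a b y : a != b ->
  commutes y -> has_degree a b y -> y = 0.
Proof.
case: ltngtP => // ab _ yA dy; last exact: commutant_degree_gt ab yA dy.
rewrite -[y]starK (commutant_degree_gt ab (star_commutes yA)) ?star0 //.
exact: degree_star.
Qed.

(** The component [y] of degree 0 is scalar by irreducibility, and all components of [x - y]
    vanish. *)
Lemma commutant_scalar x : commutes x -> scalars O x.
Proof.
move=> xA; have [y xy] := fcoef_cvg 0 0 x.
have dy := fcoef_lim_degree xy; have yA := fcoef_lim_commutes xA xy.
have ys : scalars O y by rewrite -irr; split=> //; apply: degree_fixed dy.
suff : x - y = 0 by move/eqP; rewrite subr_eq0 => /eqP ->.
have xyA : commutes (x - y) by move=> s As; rewrite mulrBl mulrBr xA // yA.
apply: fcoef_eq0 => a b; have [ab|ab] := eqVneq a b; last first.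
  have [w xw] := fcoef_cvg a b (x - y).
  rewrite -(commutant_degree_neq ab (fcoef_lim_commutes xyA xw)) //.
  exact: fcoef_lim_degree xw.
(* All pairs with [a = b] describe the same degree 0. *)
have diag N : fcoef a b N x = fcoef 0 0 N x.
  congr (_ *: _); apply: eq_bigr => j _.
  by rewrite ab !chi_diag ?norm_omegaX.
move=> e e0; have [N0 H] := xy e e0; exists (maxn N0 (a + b)) => N.
rewrite geq_max => /andP[N0N abN]; rewrite subr0 fcoefB diag.
rewrite (fcoef_degree (a := a) (b := b) dy); [|lia..].
by rewrite !addn0 ab eqxx H.
Qed.

End Commutant.

End Gauge.

Theorem corollary2p9 (R : realType) (O : cstarAlg R) (n : nat)
    (S : 'I_n -> O) (gamma : R[i] -> O -> O) (A : set O) :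
  (2 <= n)%N ->
  cuntz_algebra S ->
  gauge_action S gamma ->
  cstar_subalgebra A ->
  A `<=` gauge_fixed gamma ->
  relative_commutant A (gauge_fixed gamma) = scalars O ->
  relative_commutant A setT = scalars O.
Proof.
move=> n1 cS gS sA Afix irr; apply/seteqP; split=> x.
  by case=> _; apply: (commutant_scalar cS gS).
by move=> sx; split=> // s _; apply: scalars_comm.
Qed.
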